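(* Let $0<q<1$, $v>-1$, and let $\omega:\mathbb R\to\mathbb R$ be an even function with $\omega(q^n)\neq 0$ for all $n\in\mathbb Z$. Let $d\mu(x)=\omega(x)^2|x|^{2v+1}d_qx$, where $d_qx=(1-q)\sum_{n\in\mathbb Z}q^n\delta_{q^n}$, and assume $\mu$ has finite moments $s_n=\int x^n\,d\mu(x)$ of all orders. If $$\lim_{n\rightarrow\infty}q^{n/4}\,(s_{2n})^{1/(2n)}=0,$$ then $\mu$ is determinate.
   Context: $\delta_a$ denotes the Dirac mass at $a$. A positive measure $\mu$ on $\mathbb R$ with moments of all orders and infinite support is called determinate if it is the only positive measure on $\mathbb R$ having the same moments $s_n=\int x^n d\mu(x)$ for all $n\ge 0$. *)

(* Defs.v *)
From HB Require Import structures.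
From mathcomp Require Import all_boot all_order all_algebra.
From mathcomp Require Import all_classical all_reals all_analysis.
Set Implicit Arguments. Unset Strict Implicit. Unset Printing Implicit Defensive.
Import Order.TTheory GRing.Theory Num.Theory.
Import numFieldNormedType.Exports.
Local Open Scope classical_set_scope.
Local Open Scope ring_scope.

(* Mass of the atom q^n (n : int) of
   d mu(x) = omega(x)^2 |x|^(2v+1) d_q x,  d_q x = (1-q) sum_n q^n delta_{q^n}.
   At x = q^n > 0 we have |x|^(2v+1) = (q^n) `^ (2v+1). *)
Definition qweight (R : realType) (q v : R) (omega : R -> R) (n : int) : R :=
  (1 - q) * q ^ n * (omega (q ^ n)) ^+ 2 * (q ^ n) `^ (2 * v + 1).

Definition qmu (R : realType) (q v : R) (omega : R -> R) (A : set R) : \bar R :=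
  \esum_(n in [set n : int | A (q ^ n)]) (qweight q v omega n)%:E.

(* k-th moment s_k = \int x^k d mu(x) = sum_n mass_n * (q^n)^k
   (all terms are nonnegative since the atoms are positive). *)
Definition qmoment (R : realType) (q v : R) (omega : R -> R) (k : nat) : \bar R :=
  \esum_(n in [set: int]) (qweight q v omega n * (q ^ n) ^+ k)%:E.

Definition qdeterminate (R : realType) (q v : R) (omega : R -> R) : Prop :=
  forall nu : {measure set R -> \bar R},
    (forall k : nat, nu.-integrable setT (fun x => (x ^+ k)%:E) /\
       (\int[nu]_x (x ^+ k)%:E = qmoment q v omega k)%E) ->
    forall A : set R, measurable A -> nu A = qmu q v omega A.

(* Main.v *)
(* Let nu have the moments of mu, and fix an atom q^n; write y = x / q^n.  For
   N = 6K + 1 let P_K be the polynomial in y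
     y^K prod_{1<=i<=K} (y - q^i)/(1 - q^i) prod_{1<=i<=N} (1 - q^i y)/(1 - q^i),
   which is 1 at y = 1 and vanishes at the 7K + 1 nearest other atoms; on the
   remaining ones it is tiny near 0, and at infinity P_K^2 is at most
   q^(N(N+1)) y^(2(2K+N)) up to a factor exponential in K, which the growth
   s_{2n} = O(q^(-n^2/2)) absorbs.
   The polynomial Q = 2P - P^2 - h - (y-1)^2 P^2 / (h d^2) lies below the
   indicator of |y - 1| < d on the whole line, while at the atoms it exceeds the
   indicator of y = 1 up to a small error.  Integrating Q against nu and mu,
   which gives the same value, and letting K -> oo, then h, d -> 0, yields
   mu{q^n} <= nu{q^n}.  Hence mu <= nu, and equality holds because both have
   the same finite total mass. *)
Require Import Defs.
From HB Require Import structures.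
From mathcomp Require Import all_boot all_order all_algebra.
From mathcomp Require Import all_classical all_reals all_analysis measurable_realfun.
From mathcomp Require Import ring lra zify.
Set Implicit Arguments. Unset Strict Implicit. Unset Printing Implicit Defensive.
Import Order.TTheory GRing.Theory Num.Theory.
Import numFieldNormedType.Exports.
Local Open Scope classical_set_scope.
Local Open Scope ring_scope.

(** * The sieve polynomial and its size at the powers of q *)

(** The polynomial P_K in the rescaled variable y, for which the atoms are again the powers of q.
    [K] and [N] stay independent until the error is estimated in [sieve_error_cvg]. *)
Definition sieve (R : realFieldType) (q : R) (K N : nat) : {poly R} :=
  'X^K * \prod_(i < K) ((1 - q ^+ i.+1)^-1 *: ('X - (q ^+ i.+1)%:P))
       * \prod_(i < N) ((1 - q ^+ i.+1)^-1 *: (1 - q ^+ i.+1 *: 'X)).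

Lemma sieveE (R : realFieldType) (q : R) (K N : nat) (y : R) :
  (sieve q K N).[y] =
  y ^+ K * \prod_(i < K) ((1 - q ^+ i.+1)^-1 * (y - q ^+ i.+1))
         * \prod_(i < N) ((1 - q ^+ i.+1)^-1 * (1 - q ^+ i.+1 * y)).
Proof.
rewrite /sieve !hornerM hornerXn !horner_prod.
by congr (_ * _ * _); apply: eq_bigr => i _; rewrite !hornerE.
Qed.

Lemma exprS_lt1 (R : realFieldType) (q : R) (i : nat) :
  0 < q -> q < 1 -> q ^+ i.+1 < 1.
Proof. by move=> q0 q1; rewrite exprn_ilt1 ?ltW. Qed.

Lemma sieve1 (R : realFieldType) (q : R) (K N : nat) :
  0 < q -> q < 1 -> (sieve q K N).[1] = 1.
Proof.
move=> q0 q1; have H i : (1 - q ^+ i.+1)^-1 * (1 - q ^+ i.+1) = 1.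
  by rewrite mulVf // subr_eq0 eq_sym lt_eqF // exprS_lt1.
rewrite sieveE expr1n mul1r big1 ?mul1r => [|i _]; last exact: H.
by rewrite big1 // => i _; rewrite mulr1 H.
Qed.

Lemma sieve_root_pos (R : realFieldType) (q : R) (K N m : nat) :
  (m < K)%N -> (sieve q K N).[q ^+ m.+1] = 0.
Proof.
by move=> mK; rewrite sieveE (bigD1 (Ordinal mK)) //= subrr !(mulr0, mul0r).
Qed.

Lemma sieve_root_neg (R : realFieldType) (q : R) (K N m : nat) :
  0 < q -> (m < N)%N -> (sieve q K N).[(q ^+ m.+1)^-1] = 0.
Proof.
move=> q0 mN; rewrite sieveE (bigD1 (Ordinal mN)) //=.
by rewrite mulfV ?subrr ?(mulr0, mul0r) // expf_neq0 // gt_eqF.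
Qed.

Lemma norm_sieve_factor (R : realFieldType) (q a b : R) (i : nat) :
  0 < q -> q < 1 -> `|a| <= b ->
  `|(1 - q ^+ i.+1)^-1 * a| <= (1 - q)^-1 * b.
Proof.
move=> q0 q1 ab; rewrite normrM ler_pM //.
have qi := exprS_lt1 i q0 q1.
rewrite gtr0_norm ?invr_gt0 ?subr_gt0 // lef_pV2 ?posrE ?subr_gt0 //.
by rewrite lerB // ler_iXnr // ltW.
Qed.

(** Only the factor [y ^+ K] supplies smallness: the numerators y - q^i and 1 - q^i y lie in
    [-1, 1], and each of the [K + N] normalisations costs at most 1/(1 - q). *)
Lemma sieve_small (R : realFieldType) (q : R) (K N : nat) (y : R) :
  0 < q -> q < 1 -> 0 <= y -> y <= q ^+ K ->
  `|(sieve q K N).[y]| <= q ^+ (K * K) * (1 - q)^-1 ^+ (K + N).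
Proof.
move=> q0 q1 y0 yK; have qn i : q ^+ i <= 1 by rewrite exprn_ile1 // ltW.
have qp i : 0 <= q ^+ i by rewrite exprn_ge0 // ltW.
have y1 : y <= 1 by apply: le_trans yK _.
rewrite sieveE !normrM !normr_prod normrX (ger0_norm y0) exprD mulrA.
apply: ler_pM; rewrite ?mulr_ge0 ?exprn_ge0 ?prodr_ge0 //; last first.
  rewrite -[X in _ ^+ X](card_ord N) -prodr_const; apply: ler_prod => i _.
  rewrite normr_ge0 /= -[leRHS]mulr1 norm_sieve_factor // ler_norml.
  have : q ^+ i.+1 * y <= 1 by rewrite mulr_ile1.
  have : 0 <= q ^+ i.+1 * y by rewrite mulr_ge0.
  lra.
apply: ler_pM; rewrite ?exprn_ge0 ?prodr_ge0 //.
  by rewrite exprM lerXn2r ?nnegrE.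
rewrite -[X in _ ^+ X](card_ord K) -prodr_const; apply: ler_prod => i _.
rewrite normr_ge0 /= -[leRHS]mulr1 norm_sieve_factor // ler_norml.
have := qn i.+1; have := qp i.+1; lra.
Qed.

Lemma sqr_prod_exprS (R : comNzRingType) (q : R) (N : nat) :
  (\prod_(i < N) q ^+ i.+1) ^+ 2 = q ^+ (N * N.+1).
Proof.
elim: N => [|N IH]; first by rewrite big_ord0 expr1n.
by rewrite big_ord_recr /= exprMn IH -exprM -exprD; congr (_ ^+ _); lia.
Qed.

(** Here q^i y >= 1 for all i <= N, so |1 - q^i y| <= q^i y and |y - q^i| <= y. The product of the
    q^i is the gain that has to beat the growth of the moments. *)
Lemma sieve_large (R : realFieldType) (q : R) (K N : nat) (y : R) :
  0 < q -> q < 1 -> 1 <= q ^+ N * y ->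
  `|(sieve q K N).[y]| <=
    y ^+ (K + K + N) * \prod_(i < N) q ^+ i.+1 * (1 - q)^-1 ^+ (K + N).
Proof.
move=> q0 q1 yN; have qn i : q ^+ i <= 1 by rewrite exprn_ile1 // ltW.
have qp i : 0 < q ^+ i by rewrite exprn_gt0.
have y0 : 0 < y by rewrite -(pmulr_rgt0 _ (qp N)) (lt_le_trans _ yN).
have y1 : 1 <= y by apply: le_trans yN _; rewrite ler_piMl // ltW.
have c0 : 0 <= (1 - q)^-1 by rewrite invr_ge0 subr_ge0 ltW.
rewrite sieveE !normrM !normr_prod normrX (ger0_norm (ltW y0)).
have -> : y ^+ (K + K + N) * \prod_(i < N) q ^+ i.+1 * (1 - q)^-1 ^+ (K + N) =
    y ^+ K * \prod_(i < K) ((1 - q)^-1 * y)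
           * \prod_(i < N) ((1 - q)^-1 * (q ^+ i.+1 * y)).
  rewrite !big_split /= !prodr_const !card_ord !exprD; ring.
apply: ler_pM; rewrite ?mulr_ge0 ?exprn_ge0 ?prodr_ge0 ?(ltW y0) //; last first.
  apply: ler_prod => i _; rewrite normr_ge0 /= norm_sieve_factor // ler_norml.
  have : 1 <= q ^+ i.+1 * y.
    apply: le_trans yN _; rewrite ler_pM2r //.
    by rewrite ler_wiXn2l ?(ltW q0) ?(ltW q1).
  lra.
apply: ler_pM; rewrite ?exprn_ge0 ?prodr_ge0 ?(ltW y0) //.
apply: ler_prod => i _; rewrite normr_ge0 /= norm_sieve_factor // ler_norml.
have := qn i.+1; have := qp i.+1; lra.
Qed.

(** A power of q other than 1 is a root, or at most q^K, or at least q^(-N); [E] adds the bounds of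
    the last two cases. The [.+1] in the exponent of q^m makes room for the weight (y - 1)^2 at
    infinity. *)
Lemma sieve_atom (R : realFieldType) (q : R) (K N : nat) (m : int) :
  0 < q -> q < 1 -> m != 0 ->
  let E := (1 - q)^-1 ^+ (2 * (K + N)) *
           (q ^+ (2 * (K * K)) +
            q ^+ (N * N.+1) * (q ^ m) ^+ (2 * (K + K + N).+1)) in
  (sieve q K N).[q ^ m] ^+ 2 <= E /\
  (q ^ m - 1) ^+ 2 * (sieve q K N).[q ^ m] ^+ 2 <= E.
Proof.
move=> q0 q1 m0 E; have qp i : 0 < q ^+ i by rewrite exprn_gt0.
have c0 : 0 <= (1 - q)^-1 by rewrite invr_ge0 subr_ge0 ltW.
have y0 : 0 < q ^ m by rewrite exprz_gt0.
set y := q ^ m in E y0 *.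
have E0 : 0 <= E.
  by rewrite mulr_ge0 ?exprn_ge0 // addr_ge0 ?mulr_ge0 ?exprn_ge0 // ltW.
have [-> | [[ys yK] | yN]] : (sieve q K N).[y] = 0 \/
   (y <= 1 /\ y <= q ^+ K) \/ 1 <= q ^+ N * y.
- rewrite /y; case: m m0 @y @E {y0 E0} => [[//|k]|k] _ /=.
    rewrite -exprnP; have [kK|kK] := ltnP k K; first by left; rewrite sieve_root_pos.
    right; left; split; first by rewrite exprn_ile1 // ltW.
    by rewrite ler_wiXn2l ?(ltW q0) ?(ltW q1) // leqW.
  rewrite NegzE -exprnN; have [kN|kN] := ltnP k N; first by left; rewrite sieve_root_neg.
  right; right; rewrite ler_pdivlMr // mul1r.
  by rewrite ler_wiXn2l ?(ltW q0) ?(ltW q1) // leqW.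
- by rewrite expr0n mulr0.
- have S : (sieve q K N).[y] ^+ 2 <= E.
    rewrite -real_normK ?num_real //.
    apply: (@le_trans _ _ ((q ^+ (K * K) * (1 - q)^-1 ^+ (K + N)) ^+ 2)).
      by rewrite lerXn2r ?nnegrE ?normr_ge0 ?mulr_ge0 ?exprn_ge0 ?(ltW q0) //
           sieve_small // ltW.
    rewrite exprMn -!exprM mulrC [((K + N) * 2)%N]mulnC [(K * K * 2)%N]mulnC.
    by rewrite ler_wpM2l ?exprn_ge0 // lerDl mulr_ge0 ?exprn_ge0 // ltW.
  split => //; apply: le_trans S; rewrite ler_piMl ?sqr_ge0 //; nra.
- have y1 : 1 <= y by apply: le_trans yN _; rewrite ler_piMl ?(ltW y0) // exprn_ile1 // ltW.
  (* As y >= 1, the weight y^2 dominates both 1 and (y - 1)^2, so one bound serves both claims. *)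
  have S : y ^+ 2 * (sieve q K N).[y] ^+ 2 <= E.
    rewrite -[_.[y] ^+ 2]real_normK ?num_real //.
    apply: (@le_trans _ _ (y ^+ 2 * (y ^+ (K + K + N) * \prod_(i < N) q ^+ i.+1 *
       (1 - q)^-1 ^+ (K + N)) ^+ 2)).
      rewrite ler_wpM2l ?sqr_ge0 // lerXn2r ?nnegrE ?normr_ge0 ?sieve_large //.
      by rewrite !mulr_ge0 ?exprn_ge0 ?prodr_ge0 // ?ltW // => i _; rewrite exprn_ge0 // ltW.
    rewrite !exprMn sqr_prod_exprS -!exprM /E [(2 * (K + N))%N]mulnC.
    rewrite [(2 * _.+1)%N](_ : _ = 2 + (K + K + N) * 2)%N; last by lia.
    rewrite exprD mulrDr -[leLHS]add0r lerD ?mulr_ge0 ?exprn_ge0 ?(ltW q0) //.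
    by rewrite le_eqVlt; apply/orP; left; apply/eqP; ring.
  split; apply: le_trans S.
    by rewrite ler_peMl ?sqr_ge0 // exprn_ege1.
  by rewrite ler_wpM2r ?sqr_ge0 //; nra.
Qed.

(** * Pointwise bounds for the bump built from the sieve *)

(* Completing squares: [2 p <= h + p ^ 2 / h], and [h d ^ 2 <= h (y - 1) ^ 2]
   away from [1]. *)
Lemma bump_le (R : realFieldType) (h d p y : R) : 0 < h -> 0 < d ->
  2 * p - p ^+ 2 - h - (h * d ^+ 2)^-1 * ((y - 1) ^+ 2 * p ^+ 2)
    <= (`|y - 1| < d)%R%:R.
Proof.
move=> h0 d0; have C0 : 0 < (h * d ^+ 2)^-1 by rewrite invr_gt0 mulr_gt0 ?exprn_gt0.
have [yd|yd] := ltP `|y - 1| d.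
  have : 0 <= (h * d ^+ 2)^-1 * ((y - 1) ^+ 2 * p ^+ 2).
    by apply: mulr_ge0 (ltW C0) (mulr_ge0 (sqr_ge0 _) (sqr_ge0 _)).
  have := sqr_ge0 (p - 1); rewrite mulr1n; nra.
have yd2 : d ^+ 2 <= (y - 1) ^+ 2.
  by rewrite -[(y - 1) ^+ 2]real_normK ?num_real // lerXn2r ?nnegrE ?(ltW d0).
have : h^-1 * p ^+ 2 <= (h * d ^+ 2)^-1 * ((y - 1) ^+ 2 * p ^+ 2).
  rewrite [leRHS]mulrA ler_wpM2r ?sqr_ge0 // invfM -mulrA ler_peMr ?invr_ge0 ?(ltW h0) //.
  by rewrite mulrC ler_pdivlMr ?mul1r // exprn_gt0.
have : 0 <= h^-1 * (p - h) ^+ 2 by rewrite mulr_ge0 ?sqr_ge0 ?invr_ge0 ?(ltW h0).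
have -> : h^-1 * (p - h) ^+ 2 = h^-1 * p ^+ 2 - 2 * p + h.
  by field; rewrite gt_eqF.
have := sqr_ge0 p; rewrite mulr0n; lra.
Qed.

(** The square of p + h gives -2p <= h + p^2 / h. Together with the subtracted h this costs 2h, and
    the multiples of p^2 and (y - 1)^2 p^2 are paid for by [E]. *)
Lemma bump_ge (R : realFieldType) (h C p y E : R) : 0 < h -> 0 <= C ->
  p ^+ 2 <= E -> (y - 1) ^+ 2 * p ^+ 2 <= E ->
  0 <= 2 * p - p ^+ 2 - h - C * ((y - 1) ^+ 2 * p ^+ 2)
       + 2 * h + (1 + h^-1 + C) * E.
Proof.
move=> h0 C0 pE ypE.
have : 0 <= h^-1 * (p + h) ^+ 2 by rewrite mulr_ge0 ?sqr_ge0 ?invr_ge0 ?(ltW h0).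
have -> : h^-1 * (p + h) ^+ 2 = h^-1 * p ^+ 2 + 2 * p + h.
  by field; rewrite gt_eqF.
have : h^-1 * p ^+ 2 <= h^-1 * E by rewrite ler_wpM2l ?invr_ge0 ?(ltW h0).
have := ler_wpM2l C0 ypE; lra.
Qed.

(** * Sums and integrals of polynomials in terms of moments *)

(** The inequality [le] holds for every nonnegative factor; applied to the inverse of a positive [c]
    it yields the converse. *)
Lemma esumZl (R : realType) (I : choiceType) (D : set I) (f : I -> \bar R) (c : R) :
  0 <= c -> (forall i, 0 <= f i)%E ->
  (\esum_(i in D) (c%:E * f i) = c%:E * \esum_(i in D) f i)%E.
Proof.
have le (k : R) g : 0 <= k -> (forall i, 0 <= g i)%E ->
    (\esum_(i in D) (k%:E * g i) <= k%:E * \esum_(i in D) g i)%E.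
  move=> k0 g0; apply: ge_ereal_sup => _ [X XD <-].
  rewrite -ge0_mule_fsumr // lee_wpmul2l ?lee_fin //.
  by apply: esum_ge; exists X.
rewrite le_eqVlt => /orP[/eqP <- f0|c0 f0].
  by rewrite mul0e esum1 // => i _; rewrite mul0e.
have cK x : (x = c^-1%:E * (c%:E * x))%E.
  by rewrite muleA -EFinM mulVf ?gt_eqF // mul1e.
apply/eqP; rewrite eq_le le ?(ltW c0) //=.
rewrite [leRHS](_ : _ = c%:E * (c^-1%:E * \esum_(i in D) (c%:E * f i)))%E; last first.
  by rewrite muleA -EFinM mulfV ?gt_eqF // mul1e.
rewrite lee_wpmul2l ?lee_fin ?(ltW c0) //.
under [leLHS]eq_esum => i _ do rewrite [f i]cK.
rewrite le ?invr_ge0 ?(ltW c0) // => i.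
by rewrite mule_ge0 ?f0 // lee_fin ltW.
Qed.

Lemma esum_powers (R : realType) (I : choiceType) (w x : I -> R) (s a : nat -> R)
    (n : nat) :
  (forall i, 0 <= w i) -> (forall i, 0 <= x i) -> (forall k, 0 <= a k) ->
  (forall k, \esum_(i in [set: I]) (w i * x i ^+ k)%:E = (s k)%:E) ->
  \esum_(i in [set: I]) (w i * \sum_(k < n) a k * x i ^+ k)%:E =
  (\sum_(k < n) a k * s k)%:E.
Proof.
move=> w0 x0 a0 ws; rewrite -sumEFin.
transitivity (\sum_(k < n) \esum_(i in [set: I]) ((a k)%:E * (w i * x i ^+ k)%:E)%E)%E.
  rewrite -esum_sum => [|i k _ _]; last first.
    by rewrite -EFinM lee_fin !mulr_ge0 ?exprn_ge0.
  apply: eq_esum => i _; rewrite mulr_sumr -sumEFin.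
  by apply: eq_bigr => k _; rewrite -EFinM mulrCA.
apply: eq_bigr => k _; rewrite esumZl ?ws // => i.
by rewrite lee_fin mulr_ge0 ?exprn_ge0.
Qed.

(* Splitting the coefficients of [p] by sign keeps all sums over the atoms
   nonnegative. *)
Lemma atom_le_moments (R : realType) (I : choiceType) (w x : I -> R)
    (s : nat -> R) (p : {poly R}) (j : I) :
  (forall i, 0 <= w i) -> (forall i, 0 <= x i) ->
  (forall k, \esum_(i in [set: I]) (w i * x i ^+ k)%:E = (s k)%:E) ->
  (forall i, 0 <= p.[x i]) -> 1 <= p.[x j] ->
  w j <= \sum_(k < size p) p`_k * s k.
Proof.
move=> w0 x0 ws p0 pj.
pose a k := Num.max p`_k 0; pose b k := Num.max (- p`_k) 0.
have a0 k : 0 <= a k by rewrite le_max lexx orbT.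
have b0 k : 0 <= b k by rewrite le_max lexx orbT.
have ab k : a k = p`_k + b k.
  by rewrite /a /b; case: (leP p`_k 0); case: (leP (- p`_k) 0); lra.
have sb i : 0 <= \sum_(k < size p) b k * x i ^+ k.
  by apply: sumr_ge0 => k _; rewrite mulr_ge0 ?exprn_ge0.
have Ea := esum_powers (size p) w0 x0 a0 ws.
have Eb := esum_powers (size p) w0 x0 b0 ws.
have : ((w j)%:E + (\sum_(k < size p) b k * s k)%:E <=
        (\sum_(k < size p) a k * s k)%:E)%E.
  rewrite -Ea -Eb.
  under [leRHS]eq_esum => i _.
    under eq_bigr do rewrite ab mulrDl.
    rewrite big_split /= -horner_coef mulrDr EFinD; over.
  rewrite esumD => [|i _|i _]; rewrite ?lee_fin ?mulr_ge0 //.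
  (* Of the sum of w_i p(x_i) only the term at [j] is kept, where p is at least 1. *)
  rewrite leeD2r //; apply: esum_ge; exists [set j]; first by split => //; exact: finite_set1.
  by rewrite fsbig_set1 lee_fin ler_peMr.
rewrite -EFinD lee_fin.
under [X in _ <= X]eq_bigr do rewrite ab mulrDl.
by rewrite big_split /= lerD2r.
Qed.

Lemma integral_poly (R : realType) (nu : {measure set R -> \bar R})
    (s : nat -> R) (p : {poly R}) :
  (forall k, nu.-integrable setT (fun x => (x ^+ k)%:E) /\
     \int[nu]_x (x ^+ k)%:E = (s k)%:E)%E ->
  nu.-integrable setT (fun x => (p.[x])%:E) /\
  (\int[nu]_x (p.[x])%:E = (\sum_(k < size p) p`_k * s k)%:E)%E.
Proof.
move=> nus.
have -> : (fun x => (p.[x])%:E) =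
    (fun x => \sum_(k < size p) ((p`_k)%:E * (x ^+ k)%:E))%E.
  by apply/funext => x; rewrite horner_coef -sumEFin.
have ik (k : 'I_(size p)) :
    nu.-integrable setT (fun x => (p`_k)%:E * (x ^+ k)%:E)%E.
  by apply: integrableZl => //; case: (nus k).
split; first exact: integrable_sum.
rewrite integral_sum //= -sumEFin; apply: eq_bigr => k _.
by rewrite integralZl //; case: (nus k) => // _ ->.
Qed.

(** * A superexponential limit, and one atom against small balls *)

(** Once A q^k <= 1/2, the sequence is dominated by 2^(-k). Factors exponential in k are absorbed
    into [A]. *)
Lemma cvg_superexp (R : realType) (q A : R) : 0 < q -> q < 1 -> 0 <= A ->
  (A * q ^+ k) ^+ k @[k --> \oo] --> (0 : R).
Proof.
move=> q0 q1 A0.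
have Aq : A * q ^+ k @[k --> \oo] --> (0 : R).
  rewrite -[X in _ --> X](mulr0 A); apply: cvgMr; apply: cvg_expr.
  by rewrite ger0_norm // ltW.
apply: (@squeeze_cvgr _ _ _ _ (cst 0) (fun k => (2^-1 : R) ^+ k)).
- near=> k; rewrite exprn_ge0 ?mulr_ge0 ?exprn_ge0 ?(ltW q0) //=.
  rewrite lerXn2r ?nnegrE ?mulr_ge0 ?exprn_ge0 ?(ltW q0) ?invr_ge0 //.
  near: k; exact: (cvgr_le _ Aq).
- exact: cvg_cst.
- apply: cvg_expr; rewrite ger0_norm; lra.
Unshelve. all: by end_near. Qed.

(** The bump [F] plus the error [E] is a polynomial [G] after rescaling, nonnegative at all atoms
    and at least 1 at q^n, so its moment sum bounds [w n]. The same sum is the integral of [G]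
    against [nu], where [F] is below the indicator of the ball and [E] involves only the moments 0
    and [M]. *)
Lemma atom_le_ball (R : realType) (q : R) (w : int -> R) (s : nat -> R)
    (nu : {measure set R -> \bar R}) (K N : nat) (h d : R) (n : int)
    (C := (1 + h^-1 + (h * d ^+ 2)^-1) * (1 - q)^-1 ^+ (2 * (K + N)))
    (M := (2 * (K + K + N).+1)%N) :
  0 < q -> q < 1 -> 0 < h -> 0 < d -> (forall m, 0 <= w m) ->
  (forall k, \esum_(m in [set: int]) (w m * (q ^ m) ^+ k)%:E = (s k)%:E) ->
  (forall k, nu.-integrable setT (fun x => (x ^+ k)%:E) /\
     \int[nu]_x (x ^+ k)%:E = (s k)%:E)%E ->
  ((w n)%:E <= nu (ball (q ^ n : R) (d * q ^ n)) +
    (2 * h * s 0%N + C * (q ^+ (2 * (K * K)) * s 0%N +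
       q ^+ (N * N.+1) * (q ^ n)^-1 ^+ M * s M))%:E)%E.
Proof.
move=> q0 q1 h0 d0 w0 ws nus.
set t := (q ^ n)^-1; set U := ball _ _; set P := sieve q K N.
have t0 : 0 < t by rewrite invr_gt0 exprz_gt0.
have c0 : 0 <= (1 - q)^-1 by rewrite invr_ge0 subr_ge0 ltW.
have D0 : 0 <= (h * d ^+ 2)^-1 by rewrite invr_ge0 mulr_ge0 ?exprn_ge0 // ltW.
have C0 : 0 <= C by rewrite mulr_ge0 ?exprn_ge0 // addr_ge0 // addr_ge0 // invr_ge0 ltW.
pose F (y : R) := 2 * P.[y] - P.[y] ^+ 2 - h -
  (h * d ^+ 2)^-1 * ((y - 1) ^+ 2 * P.[y] ^+ 2).
pose E (y : R) := 2 * h + C * (q ^+ (2 * (K * K)) + q ^+ (N * N.+1) * y ^+ M).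
have [G GE] : exists G : {poly R}, forall x, G.[x] = F (t * x) + E (t * x).
  clearbody P; exists ((2%:P * P - P ^+ 2 - h%:P -
    (h * d ^+ 2)^-1%:P * (('X - 1%:P) ^+ 2 * P ^+ 2) + (2 * h)%:P +
    C%:P * ((q ^+ (2 * (K * K)))%:P + (q ^+ (N * N.+1))%:P * 'X^M))
    \Po (t%:P * 'X)) => x.
  by rewrite horner_comp !(hornerD, hornerN, hornerM, hornerC, horner_exp, hornerX) /F /E; ring.
have tqn : t * q ^ n = 1 by rewrite mulVf // gt_eqF // exprz_gt0.
have Gn : 1 <= G.[q ^ n].
  rewrite GE tqn /F sieve1 // /E subrr expr0n /= mul0r mulr0 subr0 !expr1n.
  have : 0 <= C * (q ^+ (2 * (K * K)) + q ^+ (N * N.+1) * 1).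
    by rewrite mulr_ge0 // addr_ge0 ?mulr_ge0 ?exprn_ge0 // ltW.
  lra.
(* Rescaling sends the other atoms to q^(m - n) with nonzero exponent, where the sieve is small. *)
have G0 m : 0 <= G.[q ^ m].
  have [->|mn] := eqVneq m n; first exact: le_trans Gn.
  have mn0 : m - n != 0 by rewrite subr_eq0.
  have [S1 S2] := sieve_atom K N q0 q1 mn0.
  rewrite GE (_ : t * q ^ m = q ^ (m - n)); last first.
    by rewrite expfzDr ?gt_eqF // mulrC -invr_expz.
  have := bump_ge h0 D0 S1 S2; rewrite /F /E /C -mulrA addrA; exact.
have wG := atom_le_moments w0 (fun m => ltW (exprz_gt0 m q0)) ws G0 Gn.
have [iG IG] := integral_poly G nus.
apply: (@le_trans _ _ (\int[nu]_x (G.[x])%:E)%E); first by rewrite IG lee_fin.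
have mU : measurable U by exact: measurable_ball.
pose a := 2 * h + C * q ^+ (2 * (K * K)).
pose b := C * q ^+ (N * N.+1) * t ^+ M.
have [[i0 I0] [iM IM]] := (nus 0%N, nus M).
have ia := integrableZl measurableT a i0.
have ib := integrableZl measurableT b iM.
(* The indicator is dominated by x^0, which is integrable because [nu] has finite mass. *)
have iU : nu.-integrable setT (fun x => (\1_U x)%:E).
  apply: (le_integrable measurableT _ _ i0) => [|x _].
    exact/measurable_EFinP.
  by rewrite expr0 /= lee_fin normr1 ger0_norm // indicE lern1 leq_b1.
apply: (@le_trans _ _ (\int[nu]_x ((\1_U x)%:E +
  (a%:E * (x ^+ 0)%:E + b%:E * (x ^+ M)%:E))))%E.
  apply: le_integral => //; first by do ![exact: integrableD | apply: integrableD].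
  move=> x _; rewrite -!EFinM -!EFinD lee_fin GE.
  have := bump_le P.[t * x] (t * x) h0 d0.
  rewrite (_ : (`|t * x - 1| < d)%R%:R = \1_U x :> R) /F; last first.
    rewrite indicE -tqn -mulrBr normrM (gtr0_norm t0) distrC -ltr_pdivlMl // invrK [q ^ n * d]mulrC.
    by congr (GRing.natmul _ (nat_of_bool _)); apply/idP/idP; rewrite inE.
  rewrite /E /a /b exprMn expr0; lra.
rewrite integralD //; last exact: integrableD.
rewrite integralD // !integralZl // I0 IM integral_indic // setIT.
rewrite leeD2l // -!EFinM -EFinD lee_fin /a /b.
by rewrite le_eqVlt; apply/orP; left; apply/eqP; ring.
Qed.

(** Continuity from above along the balls of radius 1/(k+1), available because the total mass is
    finite. *)
Lemma measure_set1_ge (R : realType) (nu : {measure set R -> \bar R}) (x : R)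
    (c : \bar R) :
  (nu setT < +oo)%E -> (forall d : R, 0 < d -> (c <= nu (ball x d))%E) ->
  (c <= nu [set x])%E.
Proof.
move=> nufin cd.
pose F (k : nat) : set R := ball x k.+1%:R^-1.
have mF k : measurable (F k) by exact: measurable_ball.
have FE : \bigcap_k F k = [set x].
  apply/seteqP; split => [y Fy|y -> k _]; last by apply: ballxx; rewrite invr_gt0.
  apply/eqP; rewrite eq_sym -subr_eq0 -normr_le0; apply/ler_addgt0Pr => e e0.
  rewrite add0r; have /ltr_add_invr[k] := e0; rewrite add0r => ke.
  by apply/ltW; apply: lt_trans ke; exact: (Fy k I).
have := @nonincreasing_cvg_mu _ _ _ nu F; rewrite FE => /(_ _ mF (measurable_set1 x)) H.
apply: (@cvge_ge _ _ _ _ (nu \o F)) (H _ _).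
- by near=> k; apply: cd; rewrite invr_gt0.
- by apply: le_lt_trans nufin; apply: le_measure; rewrite ?inE.
- move=> i j ij; apply/subsetPset; apply: le_ball.
  by rewrite lef_pV2 ?posrE // ler_nat.
Unshelve. all: by end_near. Qed.

(** * Growth of the moments and vanishing of the error *)

(** Eventually the sequence is at most 1, and its power 4n clears both the root and the fractional
    exponent. This is s_{2n} <= q^(-n^2/2), squared to keep integer exponents. *)
Lemma powR_moment_decay (R : realType) (q : R) (s : nat -> R) :
  0 < q -> (forall k, 0 <= s k) ->
  (fun n : nat => q `^ (n%:R / 4) * (s n.*2) `^ (n.*2%:R)^-1) @ \oo --> (0 : R) ->
  \forall n \near \oo, q ^+ (n * n) * s n.*2 ^+ 2 <= 1.
Proof.
move=> q0 s0 /cvgr_le /(_ 1 ltr01) Hle; near=> n.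
have n0 : (0 < n)%N by near: n; exists 1%N.
have : q `^ (n%:R / 4) * (s n.*2) `^ (n.*2%:R)^-1 <= 1 by near: n.
have <- : (q `^ (n%:R / 4)) ^+ (4 * n) = q ^+ (n * n).
  rewrite -powR_mulrn ?powR_ge0 // -powRrM -powR_mulrn ?(ltW q0) //.
  by congr (_ `^ _); rewrite !natrM; field.
have <- : ((s n.*2) `^ (n.*2%:R)^-1) ^+ (4 * n) = s n.*2 ^+ 2.
  rewrite -powR_mulrn ?powR_ge0 // -powRrM -powR_mulrn //.
  by congr (_ `^ _); rewrite -muln2 !natrM; field; rewrite pnatr_eq0 -lt0n.
by move=> uv1; rewrite -exprMn exprn_ile1 // mulr_ge0 ?powR_ge0.
Unshelve. all: by end_near. Qed.

(** With N = 6K + 1 one has M = 2n for n = 8K + 2. The gain N(N+1) = 36K^2 + 18K + 2 exceeds the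
    loss n^2/2 = 32K^2 + 16K + 2 by 4K^2 + 2K, which outweighs everything exponential in K. *)
Lemma sieve_error_cvg (R : realType) (q B c t : R) (s : nat -> R) :
  0 < q -> q < 1 -> 0 <= B -> 0 <= c -> 0 <= t -> (forall k, 0 <= s k) ->
  (\forall n \near \oo, q ^+ (n * n) * s n.*2 ^+ 2 <= 1) ->
  forall e : R, 0 < e -> exists K : nat, let N := (6 * K).+1 in
    let M := (2 * (K + K + N).+1)%N in
    is_true (B * c ^+ (2 * (K + N)) *
      (q ^+ (2 * (K * K)) * s 0%N + q ^+ (N * N.+1) * t ^+ M * s M) <= e).
Proof.
move=> q0 q1 B0 c0 t0 s0 sdec e e0.
have qa a b : (b <= a)%N -> q ^+ a <= q ^+ b.
  by move=> ba; rewrite ler_wiXn2l ?(ltW q0) ?(ltW q1).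
have qp i : 0 < q ^+ i by rewrite exprn_gt0.
(* A majorant of the error: the powers of [c] and [t] come from 2(K + N) = 2 + 14K and M = 4 + 16K,
   and both powers of q are weakened to q^(K^2). *)
pose u (K : nat) := B * c ^+ 2 * s 0%N * (c ^+ 14 * q ^+ K) ^+ K
  + B * c ^+ 2 * t ^+ 4 * (c ^+ 14 * t ^+ 16 * q ^+ K) ^+ K.
have ucvg : u @ \oo --> (0 : R).
  rewrite -[X in _ --> X](addr0 0) -[X in X + _](mulr0 (B * c ^+ 2 * s 0%N)).
  rewrite -[X in _ + X](mulr0 (B * c ^+ 2 * t ^+ 4)).
  by apply: cvgD; apply: cvgMr; apply: cvg_superexp; rewrite ?mulr_ge0 ?exprn_ge0.
have cvgS : (8 * K + 2)%N @[K --> \oo] --> \oo.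
  apply/cvgnyPge => A; near=> K.
  have AK : (A <= K)%N by near: K; exact: nbhs_infty_ge.
  lia.
have ule : \forall K \near \oo, u K <= e by exact: cvgr_le ucvg _ e0.
have sle := cvgS _ sdec.
have [K [uK sK]] := @filter_ex _ _ _ _ (filterI ule sle).
exists K => N M; apply: le_trans uK.
have EM : M = (8 * K + 2).*2 by lia.
(* The square root of the decay estimate at n = 8K + 2; n^2 is even, so its half is an integer
   exponent. *)
have {}sK : q ^+ (32 * (K * K) + 16 * K + 2) * s M <= 1.
  rewrite -(@expr_le1 _ 2) ?mulr_ge0 ?(ltW (qp _)) // exprMn -exprM EM.
  by rewrite (_ : (_ * 2 = (8 * K + 2) * (8 * K + 2))%N) //; lia.
have b1 : q ^+ (2 * (K * K)) <= (q ^+ K) ^+ K by rewrite -exprM qa //; lia.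
have b2 : q ^+ (N * N.+1) * s M <= (q ^+ K) ^+ K.
  rewrite (_ : N * N.+1 = (4 * (K * K) + 2 * K) + (32 * (K * K) + 16 * K + 2))%N; last by lia.
  rewrite exprD -mulrA -[leRHS]mulr1 ler_pM ?mulr_ge0 ?(ltW (qp _)) //.
  by rewrite -exprM qa //; lia.
have -> : u K = B * c ^+ (2 * (K + N)) *
    ((q ^+ K) ^+ K * s 0%N + t ^+ M * (q ^+ K) ^+ K).
  rewrite /u !exprMn -!exprM (_ : 2 * (K + N) = 2 + 14 * K)%N; last by lia.
  by rewrite (_ : M = 4 + 16 * K)%N; [rewrite !exprD; ring | lia].
rewrite ler_wpM2l ?mulr_ge0 ?exprn_ge0 // lerD ?ler_wpM2r //.
by rewrite mulrAC mulrC ler_wpM2l ?exprn_ge0.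
Unshelve. all: by end_near. Qed.

(** * From single atoms to all measurable sets *)

(** The sum is a supremum over finite subfamilies; by injectivity their points are distinct, so
    additivity of [nu] on disjoint singletons applies. *)
Lemma atoms_le_measure (R : realType) (I : choiceType) (x w : I -> R)
    (nu : {measure set R -> \bar R}) (A : set R) :
  injective x -> measurable A ->
  (forall i, (w i)%:E <= nu [set x i])%E ->
  (\esum_(i in [set i | A (x i)]) (w i)%:E <= nu A)%E.
Proof.
move=> xI mA wnu; apply: ge_ereal_sup => _ [X [finX XA] <-].
apply: (@le_trans _ _ (\sum_(i \in X) nu [set x i])%E).
  by apply: lee_fsum => // i _.
rewrite -measure_fin_bigcup //; last first.
  by move=> i j _ _ [_ [-> /xI]].
have mU : measurable (\bigcup_(i in X) [set x i]).
  by apply: fin_bigcup_measurable.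
apply: le_measure; rewrite ?inE //.
by move=> _ [i Xi ->]; exact: XA.
Qed.

Lemma exprz_inj (R : realFieldType) (q : R) : 0 < q -> q < 1 ->
  injective (fun n : int => q ^ n).
Proof.
move=> q0 q1 m n qmn; apply/eqP; rewrite -subr_eq0; apply/eqP.
have : q ^ (m - n) = 1 by rewrite expfzDr ?gt_eqF // qmn -expfzDr ?gt_eqF // subrr.
case: (m - n) => [[//|k]|k] /eqP.
  by rewrite -exprnP lt_eqF // exprn_ilt1 // ltW.
by rewrite NegzE -exprnN invr_eq1 lt_eqF // exprn_ilt1 // ltW.
Qed.

Theorem theorem2 (R : realType) (q v : R) (omega : R -> R) :
  0 < q -> q < 1 -> -1 < v ->
  (forall x, omega (- x) = omega x) ->
  (forall n : int, omega (q ^ n) != 0) ->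
  (forall k : nat, (qmoment q v omega k < +oo)%E) ->
  (fun n : nat => q `^ (n%:R / 4) * (fine (qmoment q v omega n.*2)) `^ (n.*2%:R)^-1)
    @ \oo --> (0 : R) ->
  qdeterminate q v omega.
Proof.
move=> q0 q1 _ _ _ mfin mcvg nu numom.
pose w := qweight q v omega; pose s k := fine (qmoment q v omega k).
have w0 m : 0 <= w m.
  by rewrite /w /qweight mulr_ge0 ?powR_ge0 // mulr_ge0 ?sqr_ge0 // mulr_ge0 ?subr_ge0 ?exprz_ge0 // ltW.
have m0 k : (0 <= qmoment q v omega k)%E.
  by apply: esum_ge0 => n _; rewrite lee_fin mulr_ge0 ?exprn_ge0 ?exprz_ge0 ?w0 // ltW.
have s0 k : 0 <= s k by exact: fine_ge0.
have sE k : qmoment q v omega k = (s k)%:E.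
  by rewrite /s fineK // ge0_fin_numE.
have ws k : \esum_(m in [set: int]) (w m * (q ^ m) ^+ k)%:E = (s k)%:E.
  by rewrite -sE.
have nus k : nu.-integrable setT (fun x => (x ^+ k)%:E) /\
    (\int[nu]_x (x ^+ k)%:E = (s k)%:E)%E by rewrite -sE.
have sdec := powR_moment_decay q0 s0 mcvg.
have nuT : nu setT = (s 0%N)%:E.
  have [_ <-] := nus 0%N; under eq_integral do rewrite expr0.
  by rewrite integral_cst // mul1e.
have wnu n : ((w n)%:E <= nu [set q ^ n])%E.
  apply: measure_set1_ge => [|r r0]; first by rewrite nuT ltry.
  apply/lee_addgt0Pr => e e0.
  have qn0 : 0 < q ^ n by rewrite exprz_gt0.
  have d0 : 0 < r / q ^ n by rewrite divr_gt0.
  (* This [h] makes 2 h s_0 at most e/2, the added 1 avoiding division by zero; this [d] turns the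
     radius d q^n into r. *)
  pose h := e / (4 * (s 0%N + 1)); pose d := r / q ^ n.
  have h0 : 0 < h by rewrite divr_gt0 // mulr_gt0 // ltr_wpDl.
  have B0 : 0 <= 1 + h^-1 + (h * d ^+ 2)^-1.
    rewrite addr_ge0 ?addr_ge0 ?invr_ge0 ?(ltW h0) //.
    by rewrite (mulr_ge0 (ltW h0)) // exprn_ge0 // ltW.
  have c0 : 0 <= (1 - q)^-1 by rewrite invr_ge0 subr_ge0 ltW.
  have t0 : 0 <= (q ^ n)^-1 by rewrite invr_ge0 ltW.
  have e20 : 0 < e / 2 by rewrite divr_gt0.
  have [K HK] := sieve_error_cvg q0 q1 B0 c0 t0 s0 sdec e20.
  have := atom_le_ball K (6 * K).+1 n q0 q1 h0 d0 w0 ws nus.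
  rewrite divfK ?gt_eqF // => /le_trans; apply; rewrite leeD2l // lee_fin.
  have : 2 * h * s 0%N <= e / 2.
    rewrite /h [leLHS](_ : _ = e / 2 * (s 0%N / (s 0%N + 1))); last first.
      by field; rewrite gt_eqF // ltr_wpDl.
    by rewrite ler_piMr ?(ltW e20) // ler_pdivrMr ?ltr_wpDl // mul1r lerDl.
  by move=> hs; rewrite [leRHS](splitr e) lerD.
have le_nu := atoms_le_measure (exprz_inj q0 q1) _ wnu.
(* For the converse, both measures have total mass s_0, so nu(A) > mu(A) would force nu < mu on the
   complement of [A]. Finiteness of nu there allows the cancellation. *)
move=> A mA; apply/eqP; rewrite eq_le; apply/andP; split; last exact: le_nu.
have mAC : measurable (~` A) by exact: measurableC.
have muE : (nu setT = qmu q v omega A + qmu q v omega (~` A))%E.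
  rewrite nuT -(ws 0%N) (esumID [set n : int | A (q ^ n)]) => [|n _]; last first.
    by rewrite expr0 mulr1 lee_fin.
  by rewrite !setTI; congr (_ + _)%E; apply: eq_esum => n _; rewrite expr0 mulr1.
have nuE : (nu setT = nu A + nu (~` A))%E by rewrite -measureU ?setICr // setUv.
have fAC : nu (~` A) \is a fin_num.
  by rewrite ge0_fin_numE // (@le_lt_trans _ _ (nu setT)) ?nuT ?ltry // -nuT le_measure ?inE.
rewrite -(@leeD2rE _ (nu (~` A))) //; apply: (@le_trans _ _ (nu setT)).
  by rewrite nuE.
by rewrite muE leeD2l // le_nu.
Qed.
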